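(* Let $D_m=(X_1,\ldots,X_m)$ be i.i.d. observations from a distribution $P$, let $\theta_0=\phi(P)\in\mathbb R^d$ be a functional of $P$, $\widehat\theta_m=\phi(P_m)$ with $P_m$ the empirical distribution of $X_1,\ldots,X_m$, $S:\mathbb R^d\to\mathbb R$ a function, $\tau_m$ a normalizing rate, and $S_m(\theta)=S(\tau_m(\widehat\theta_m-\theta))$. For $b=1,\ldots,B$ let $(X_1^{*b},\ldots,X_m^{*b})$ be bootstrap samples of size $m$ drawn from $P_m$ (independently across $b$ given $D_m$), $\widehat\theta_m^{*b}=\phi(P_m^{*b})$ with $P_m^{*b}$ the empirical distribution of the $b$-th bootstrap sample, and $W_b=S(\tau_m(\widehat\theta_m^{*b}-\widehat\theta_m))$, with order statistics $W_{(1)}\le\cdots\le W_{(B)}$. Let $\alpha\in(0,1)$ and $B\ge(2/\alpha)-1$, and let $U$ be a Uniform$(0,1)$ random variable independent of everything else. Put $\ell=\lfloor(B+1)(\alpha/2)\rfloor$, $$\tau_{\alpha,B}=\begin{cases}1&\text{if }(B+1)(1-\alpha)\in\mathbb N,\\[2pt] \dfrac{(1-\alpha)-\lfloor(B+1)(1-\alpha)\rfloor/(B+1)}{(\lceil(B+1)(1-\alpha)\rceil-\lfloor(B+1)(1-\alpha)\rfloor)/(B+1)}&\text{otherwise},\end{cases}$$ and define the randomized confidence set $$\mathrm{CI}^{\mathrm{rand}}=\begin{cases}\{\theta:S_m(\theta)\in[W_{(\ell)},W_{(\lceil(B+1)(1-\alpha)\rceil+\ell)})\}&\text{if }U\le\tau_{\alpha,B},\\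 \{\theta:S_m(\theta)\in[W_{(\ell)},W_{(\lfloor(B+1)(1-\alpha)\rfloor+\ell)})\}&\text{if }U>\tau_{\alpha,B}.\end{cases}$$ Then, with $F_0(D_m)=\mathbb P(W_b\le S_m(\theta_0)\mid D_m)$, $$\big|\mathbb P(\theta_0\in\mathrm{CI}^{\mathrm{rand}})-(1-\alpha)\big|\le\widetilde d_{\mathrm{KS}}(F_0(D_m),U(0,1)).$$
   Context: All maps are assumed measurable. For real random variables, $\widetilde d_{\mathrm{KS}}(Y_1,Y_2)=\sup_{s,t\in\mathbb R}|\mathbb P(Y_1\in(s,t])-\mathbb P(Y_2\in(s,t])|$; $U(0,1)$ denotes a standard uniform random variable. The probability $\mathbb P(\theta_0\in\mathrm{CI}^{\mathrm{rand}})$ is over the data, the bootstrap resampling and $U$. *)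

(* Defs.v *)
From HB Require Import structures.
From mathcomp Require Import all_boot all_order all_algebra.
From mathcomp Require Import all_classical all_reals all_analysis.
Set Implicit Arguments.
Unset Strict Implicit.
Unset Printing Implicit Defensive.
Import Order.TTheory GRing.Theory Num.Theory.
Import numFieldNormedType.Exports.
Local Open Scope classical_set_scope.
Local Open Scope ring_scope.

(* R^d carries the product of the Borel sigma-algebras of its coordinates,
   that is, its Borel sigma-algebra. *)
Definition measure_rV_display : measure_display -> measure_display.
Proof. exact. Qed.

Section measurable_rV.
Context (R : realType) (d : nat).

Let coord (i : 'I_d) (v : 'rV[R]_d) : measurableTypeR R := v ord0 i.

Let rV_set0 : g_sigma_preimage coord set0.
Proof. exact: sigma_algebra0. Qed.

Let rV_setC A : g_sigma_preimage coord A -> g_sigma_preimage coord (~` A).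
Proof. exact: sigma_algebraC. Qed.

Let rV_bigcup (F : _^nat) : (forall i, g_sigma_preimage coord (F i)) ->
  g_sigma_preimage coord (\bigcup_i F i).
Proof. exact: sigma_algebra_bigcup. Qed.

HB.instance Definition _ := @isMeasurable.Build (measure_rV_display R.-ocitv)
  ('rV[R]_d) (g_sigma_preimage coord) rV_set0 rV_setC rV_bigcup.

End measurable_rV.

Section independence.
Local Open Scope ereal_scope.
Context d (Omega : measurableType d) (R : realType) (Pr : probability Omega R).

Definition mutually_independent d' (T : measurableType d') (I : finType)
    (X : I -> Omega -> T) : Prop :=
  forall (J : {set I}) (A : I -> set T), (forall i, measurable (A i)) ->
    Pr [set w | forall i, i \in J -> A i (X i w)]
    = \prod_(i in J) Pr (X i @^-1` A i).

Definition independent d1 d2 (T1 : measurableType d1) (T2 : measurableType d2)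
    (X : Omega -> T1) (Y : Omega -> T2) : Prop :=
  forall (A1 : set T1) (A2 : set T2), measurable A1 -> measurable A2 ->
    Pr (X @^-1` A1 `&` Y @^-1` A2) = Pr (X @^-1` A1) * Pr (Y @^-1` A2).

Definition has_law d' (T : measurableType d') (X : Omega -> T)
    (mu : set T -> \bar R) : Prop :=
  forall A, measurable A -> Pr (X @^-1` A) = mu A.

Definition iid_sample d' (T : measurableType d') (m : nat)
    (D : Omega -> m.-tuple T) (P : probability T R) : Prop :=
  mutually_independent (fun i w => tnth (D w) i) /\
  forall i, has_law (fun w => tnth (D w) i) P.

(* [F (D w)] is a version of the conditional probability of [E] given [D]. *)
Definition cond_prob_version d' (T : measurableType d') (D : Omega -> T)
    (E : set Omega) (F : {mfun T >-> R}) : Prop :=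
  Pr.-integrable setT (EFin \o (F \o D)) /\
  forall A, measurable A ->
    \int[Pr]_(w in D @^-1` A) (F (D w))%:E = Pr (D @^-1` A `&` E).

End independence.

Section empirical.
Local Open Scope ereal_scope.
Context d (T : measurableType d) (R : realType) (m : nat).

Definition empirical (m0 : (0 < m)%N) (x : m.-tuple T) (A : set T) : \bar R :=
  ((m%:R^-1)%R : R)%:E * \sum_(i < m) \d_(tnth x i) A.

Variables (m0 : (0 < m)%N) (x : m.-tuple T).

Let empiricalE : empirical m0 x =
  mscale ((m%:R^-1 : R)%:nng)%R
    (msum (fun k => \d_(nth (tnth x (Ordinal m0)) x k)) m).
Proof.
apply/funext => A; rewrite /empirical /mscale /msum/=; congr (_ * _).
by apply: eq_bigr => i _; rewrite (tnth_nth (tnth x (Ordinal m0))).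
Qed.

Let empirical0 : empirical m0 x set0 = 0.
Proof. by rewrite empiricalE measure0. Qed.

Let empirical_ge0 A : 0 <= empirical m0 x A.
Proof. by rewrite empiricalE. Qed.

Let empirical_sigma_additive : semi_sigma_additive (empirical m0 x).
Proof. by rewrite empiricalE; exact: measure_semi_sigma_additive. Qed.

HB.instance Definition _ := isMeasure.Build _ _ _ (empirical m0 x)
  empirical0 empirical_ge0 empirical_sigma_additive.

Let empirical_setT : empirical m0 x setT = 1.
Proof.
rewrite /empirical; under eq_bigr do rewrite diracT.
rewrite sumEFin sumr_const card_ord -EFinM mulVf//.
by rewrite pnatr_eq0 -lt0n.
Qed.

HB.instance Definition _ := Measure_isProbability.Build _ _ _
  (empirical m0 x) empirical_setT.

End empirical.

(* Given [D = x], the [B * m] draws are i.i.d. from the empirical distribution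
   of [x]; the rectangles below determine the joint law of [D] and [Ds]. *)
Definition bootstrap_samples d (Omega : measurableType d) (R : realType)
    (Pr : probability Omega R) d' (T : measurableType d') (m B : nat)
    (m0 : (0 < m)%N) (D : Omega -> m.-tuple T)
    (Ds : 'I_B -> Omega -> m.-tuple T) : Prop :=
  forall (A : set (m.-tuple T)) (C : 'I_B -> 'I_m -> set T),
    measurable A -> (forall b i, measurable (C b i)) ->
    (Pr (D @^-1` A `&` [set w | forall b i, C b i (tnth (Ds b w) i)])
     = \int[Pr]_(w in D @^-1` A)
         \prod_(b < B) \prod_(i < m) empirical R m0 (D w) (C b i))%E.

Definition dKS (R : realType) (mu nu : set R -> \bar R) : R :=
  sup [set r | exists s t : R,
        r = `|fine (mu `]s, t]%classic) - fine (nu `]s, t]%classic)|].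

(* [order_stat W k] is the k-th smallest value of [W], for [1 <= k <= B]. *)
Definition order_stat (R : realType) (B : nat) (W : 'I_B -> R) (k : nat) : R :=
  nth 0 (sort <=%R (codom W)) k.-1.

Section randomized_confidence_set.
Context (R : realType).

(* The next two are only used at nonnegative arguments. *)
Definition nfloor (x : R) : nat := `|Num.floor x|%N.
Definition nceil (x : R) : nat := `|Num.ceil x|%N.

Definition ell (alpha : R) (B : nat) : nat :=
  nfloor (B.+1%:R * (alpha / 2)).

Definition tau_rand (alpha : R) (B : nat) : R :=
  let x := B.+1%:R * (1 - alpha) in
  if x \is a Num.nat then 1
  else ((1 - alpha) - (nfloor x)%:R / B.+1%:R)
       / (((nceil x)%:R - (nfloor x)%:R) / B.+1%:R).

Definition CI_rand (alpha : R) (B : nat) (Theta : Type) (Sm : Theta -> R)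
    (W : 'I_B -> R) (u : R) : set Theta :=
  let x := B.+1%:R * (1 - alpha) in
  let l := ell alpha B in
  if u <= tau_rand alpha B then
    [set theta | Sm theta \in
       `[order_stat W l, order_stat W (nceil x + l)%N[ ]
  else
    [set theta | Sm theta \in
       `[order_stat W l, order_stat W (nfloor x + l)%N[ ].

End randomized_confidence_set.

(* Main.v *)
Require Import Defs.
From HB Require Import structures.
From mathcomp Require Import all_boot all_order all_algebra.
From mathcomp Require Import all_classical all_reals all_analysis.
From mathcomp Require Import measurable_realfun.
From mathcomp Require Import lra ring.
Set Implicit Arguments.
Unset Strict Implicit.
Unset Printing Implicit Defensive.
Import Order.TTheory GRing.Theory Num.Theory.
Import numFieldNormedType.Exports.
Local Open Scope classical_set_scope.
Local Open Scope ring_scope.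

(* theta0 lies in the confidence set iff the number N of bootstrap statistics
   W_b below S_m(theta0) satisfies l <= N < k + l, where k is the ceiling or the
   floor of (B + 1)(1 - alpha) according to U. Given the data, N is binomial
   with B trials and success probability p = F0(D), because the B resamplings
   are independent and uniform over the m ^ m index maps.

   Write P(Bin(B, p) >= l) as the integral over [0, p] of the Beta(l, B + 1 - l)
   density f_l. With gap(u) := P(F0(D) > u) - (1 - u), Fubini gives
     P(l <= N < k + l) - k / (B + 1) = int f_l gap - int f_{k+l} gap,
   a difference of two weighted means of gap. It is bounded by the oscillation
   of gap, and gap(u) - gap(v) = P(F0(D) in (u, v]) - (v - u), whence the
   Kolmogorov-Smirnov type bound. Averaging over U turns the two values of
   k / (B + 1) into 1 - alpha. *)

(** * Order statistics and ranks *)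

(** In the sorted list the values at most [s] form a prefix, so the entry at index [k - 1] belongs
    to it exactly when the prefix has at least [k] entries. The bounds on [k] keep the index inside
    the list, away from the default of [nth]. *)
Lemma order_stat_le (R : realType) (B k : nat) (W : 'I_B -> R) (s : R) :
  (0 < k <= B)%N -> (order_stat W k <= s) = (k <= #|[pred c | (W c <= s)%R]|)%N.
Proof.
case: k => // k /= kB; rewrite /order_stat /=.
set t := sort _ _.
have st : sorted <=%R t by exact: sort_le_sorted.
have sz : size t = B by rewrite size_sort size_codom card_ord.
have ct : count (<= s) t = #|[pred c | (W c <= s)%R]|.
  rewrite (permP (permEl (perm_sort _ _))) /codom /image_mem count_map.
  rewrite cardE size_filter enumT.
  by apply: eq_count => c /=; rewrite inE.
rewrite -ct; case: ltnP => kc; first by rewrite (nth_count_le _ st kc).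
by apply/negbTE; rewrite -ltNge (nth_count_gt _ st)// kc sz.
Qed.

Lemma nfloor_itv (R : realType) (x : R) : 0 <= x ->
  (nfloor x)%:R <= x < (nfloor x)%:R + 1.
Proof.
move=> x0; rewrite /nfloor natr_absz ger0_norm ?floor_ge0//.
by have := floor_itv x; rewrite intrD.
Qed.

Lemma nceil_itv (R : realType) (x : R) : 0 <= x ->
  (nceil x)%:R - 1 < x <= (nceil x)%:R.
Proof.
move=> x0; rewrite /nceil natr_absz ger0_norm ?ceil_ge0//; last first.
  by rewrite (lt_le_trans _ x0)// ltrN10.
by have /andP[] := ceil_itv x; rewrite intrD => -> ->.
Qed.

(** * Arithmetic of the ranks in the confidence set *)

Section rank_arithmetic.
Context (R : realType) (alpha : R) (B : nat).
Hypothesis alpha01 : 0 < alpha < 1.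
Hypothesis B_ge : 2 / alpha - 1 <= B%:R.

Let x := B.+1%:R * (1 - alpha).

(** This is [B >= 2 / alpha - 1] multiplied out; it makes the lower rank at least 1. *)
Let half_ge1 : 1 <= B.+1%:R * (alpha / 2) :> R.
Proof.
case/andP: alpha01 => a0 _; rewrite mulrA ler_pdivlMr// mul1r.
by rewrite -ler_pdivrMr// -(natr1 B) -lerBlDr.
Qed.

Let x_ge0 : 0 <= x.
Proof. by case/andP: alpha01 => _ a1; rewrite mulr_ge0// subr_ge0 ltW. Qed.

Lemma ell_gt0 : (0 < ell alpha B)%N.
Proof.
have h0 : 0 <= B.+1%:R * (alpha / 2) :> R := le_trans ler01 half_ge1.
have /andP[_ h] := nfloor_itv h0.
rewrite -(ltr0n R) /ell; rewrite -(ltrD2r 1) add0r.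
exact: le_lt_trans half_ge1 h.
Qed.

(** The sum is less than [x + 1 + (B + 1) alpha / 2 = (B + 1) + 1 - (B + 1) alpha / 2], which is at
    most [B + 1] by [half_ge1]. *)
Lemma nceil_ell_le : (nceil x + ell alpha B <= B)%N.
Proof.
have h0 : 0 <= B.+1%:R * (alpha / 2) :> R := le_trans ler01 half_ge1.
have /andP[h1 _] := nfloor_itv h0.
have /andP[h2 _] := nceil_itv x_ge0.
rewrite -ltnS -(ltr_nat R) natrD /ell.
move: h1 h2 half_ge1; rewrite /x; set u := B.+1%:R; set v := (nceil _)%:R.
set w := (nfloor _)%:R => h1 h2 h3; nra.
Qed.

Lemma nfloor_le_nceil (y : R) : 0 <= y -> (nfloor y <= nceil y)%N.
Proof.
move=> y0; rewrite -(ler_nat R).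
have /andP[h1 _] := nfloor_itv y0; have /andP[_ h2] := nceil_itv y0.
exact: le_trans h1 h2.
Qed.

Lemma nfloor_ell_le : (nfloor x + ell alpha B <= B)%N.
Proof.
by rewrite (leq_trans _ nceil_ell_le)// leq_add2r nfloor_le_nceil.
Qed.

Let nceil_nat : x \is a Num.nat -> (nceil x)%:R = x.
Proof.
move=> /natrP[n ->]; congr (_%:R); rewrite /nceil.
by rewrite -[n%:R]/((Posz n)%:~R) intrKceil absz_nat.
Qed.

Let nceil_notnat : x \isn't a Num.nat -> (nfloor x).+1 = nceil x.
Proof.
move=> xN.
have /andP[h1 h2] := nfloor_itv x_ge0; have /andP[h3 h4] := nceil_itv x_ge0.
have h5 : (nfloor x)%:R < x.
  by rewrite lt_neqAle h1 andbT; apply: contra xN => /eqP <-; exact: natr_nat.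
apply/eqP; rewrite eqn_leq -(ltr_nat R) (lt_le_trans h5 h4) /=.
by rewrite -ltnS -(ltr_nat R) -!natr1; move: h2 h3; lra.
Qed.

Lemma tau_rand01 : 0 <= tau_rand alpha B <= 1.
Proof.
rewrite /tau_rand -/x; case: ifPn => [_|xN]; first by rewrite ler01 lexx.
have -> : (nceil x)%:R - (nfloor x)%:R = 1 :> R.
  by rewrite -(nceil_notnat xN) -natr1 addrAC subrr add0r.
rewrite div1r invrK.
have /andP[h1 h2] := nfloor_itv x_ge0; move: h1 h2.
rewrite mulrBl mulfVK// mulrC -/x => h1 h2; lra.
Qed.

(** When [x] is not an integer, ceiling and floor differ by 1, so [tau_rand] is the fractional part
    of [x], the weight that writes [x] as a mixture of the two. When [x] is an integer the weight is
    1 and the ceiling is [x] itself. *)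
Lemma tau_rand_mix :
  tau_rand alpha B * ((nceil x)%:R / B.+1%:R)
  + (1 - tau_rand alpha B) * ((nfloor x)%:R / B.+1%:R) = 1 - alpha.
Proof.
rewrite /tau_rand -/x; case: ifPn => [xN|xN].
  by rewrite nceil_nat// subrr mul0r addr0 mul1r /x mulrC mulKf.
have B0 : B.+1%:R != 0 :> R by [].
rewrite -(nceil_notnat xN) -(natr1 (nfloor x)) [_ + 1 - _]addrAC subrr add0r.
move: (B.+1%:R : R) ((nfloor x)%:R : R) B0 => c f c0.
by field.
Qed.

End rank_arithmetic.

(** Both ends of the interval translate through [order_stat_le]: the closed left end gives [l <= N],
    and the open right end negates the same criterion. The rank bounds above ensure that all order
    statistics involved exist. *)
Lemma CI_randE (R : realType) (alpha : R) (B : nat) (Theta : Type)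
    (Sm : Theta -> R) (W : 'I_B -> R) (u : R) (theta : Theta) :
  0 < alpha < 1 -> 2 / alpha - 1 <= B%:R ->
  let x := B.+1%:R * (1 - alpha) in
  let N := #|[pred c | (W c <= Sm theta)%R]| in
  CI_rand alpha Sm W u theta <->
  if u <= tau_rand alpha B then (ell alpha B <= N < nceil x + ell alpha B)%N
  else (ell alpha B <= N < nfloor x + ell alpha B)%N.
Proof.
move=> a01 aB x N.
have l0 := ell_gt0 a01 aB; have cB := nceil_ell_le a01 aB.
have fB := nfloor_ell_le a01 aB.
have lB : (ell alpha B <= B)%N by rewrite (leq_trans _ cB)// leq_addl.
rewrite /CI_rand -/x; case: ifP => _ /=; rewrite in_itv/= ltNge.
all: by rewrite !order_stat_le ?l0 ?lB ?addn_gt0 ?l0 ?orbT// -ltnNge.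
Qed.

(** * Binomial tails and Beta densities *)

Section binomial_polynomials.
Context (R : realType).
Implicit Types B l n : nat.

(** The probability that Bin(B, x) equals [n], as a formal polynomial in the success probability so
    that it can be differentiated algebraically. *)
Definition binom_poly B n : {poly R} :=
  'C(B, n)%:R *: ('X^n * (1 - 'X) ^+ (B - n)).

Definition binom_tail B l : {poly R} := \sum_(l <= n < B.+1) binom_poly B n.

(* The Beta(n, B + 1 - n) density; it vanishes for n = 0 and for n = B + 1,
   which makes the sum in [deriv_binom_tail] telescope. *)
Definition beta_poly B n : {poly R} :=
  (n * 'C(B, n))%:R *: ('X^(n.-1) * (1 - 'X) ^+ (B - n)).

Lemma horner_binom_poly B n x :
  (binom_poly B n).[x] = 'C(B, n)%:R * (x ^+ n * (1 - x) ^+ (B - n)).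
Proof.
by rewrite hornerZ hornerM hornerXn horner_exp hornerD hornerN hornerX hornerC.
Qed.

Lemma horner_beta_poly B n x :
  (beta_poly B n).[x] =
  (n * 'C(B, n))%:R * (x ^+ n.-1 * (1 - x) ^+ (B - n)).
Proof.
by rewrite hornerZ hornerM hornerXn horner_exp hornerD hornerN hornerX hornerC.
Qed.

(** The product rule gives two terms; the second is recognized through
    [(B - n) C(B, n) = (n + 1) C(B, n + 1)]. *)
Lemma deriv_binom_poly B n : (binom_poly B n)^`() =
  beta_poly B n - beta_poly B n.+1.
Proof.
rewrite /binom_poly /beta_poly derivZ derivM derivXn deriv_exp derivB derivX.
have -> : (1 : {poly R})^`() = 0 by rewrite -polyC1 derivC.
rewrite sub0r mul_bin_left subnS /=.
rewrite scalerDr !natrM -!scalerA !scaler_nat mulrnAl mulrnAr mulN1r mulrN.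
by rewrite !mulNrn mulrnAC [X in _ - X]mulrnAC.
Qed.

Lemma deriv_binom_tail B l : (l <= B.+1)%N ->
  (binom_tail B l)^`() = beta_poly B l.
Proof.
move=> lB; rewrite /binom_tail raddf_sum /=.
under eq_bigr do rewrite deriv_binom_poly -opprB.
rewrite sumrN telescope_sumr// opprB.
by rewrite [beta_poly B B.+1]/beta_poly bin_small// muln0 scale0r subr0.
Qed.

Lemma horner_binom_tail0 B l : (0 < l)%N -> (binom_tail B l).[0] = 0.
Proof.
move=> l0; rewrite /binom_tail horner_sum big_nat big1// => i /andP[li _].
rewrite horner_binom_poly expr0n gtn_eqF ?(leq_trans l0)//.
by rewrite mul0r mulr0.
Qed.

Lemma horner_binom_tail1 B l : (l <= B)%N -> (binom_tail B l).[1] = 1.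
Proof.
move=> lB; rewrite /binom_tail horner_sum big_nat_recr//=.
rewrite big_nat big1 => [|i /andP[_ iB]].
  by rewrite add0r horner_binom_poly binn subnn expr1n expr0 !mulr1.
rewrite horner_binom_poly subrr (expr0n _ (B - i)).
by rewrite subn_eq0 leqNgt iB !mulr0.
Qed.

Lemma horner_binom_tailB B l r p : (l <= r <= B)%N ->
  (binom_tail B l).[p] - (binom_tail B r).[p] =
  \sum_(l <= n < r) (binom_poly B n).[p].
Proof.
move=> /andP[lr rB]; rewrite /binom_tail (big_cat_nat lr (leqW rB)) hornerD.
by rewrite addrK horner_sum.
Qed.

Lemma beta_poly_ge0 B n x : 0 <= x <= 1 -> 0 <= (beta_poly B n).[x].
Proof.
move=> /andP[x0 x1]; rewrite horner_beta_poly.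
by rewrite !mulr_ge0// exprn_ge0// subr_ge0.
Qed.

(** Multiplying the Beta(l, B + 1 - l) density by [1 - x] gives a multiple of the Beta(l, B + 2 - l)
    density. The factor is therefore the mean of [1 - V] under the first law. *)
Lemma onem_beta_poly B l : (l <= B)%N ->
  (1 - 'X) * beta_poly B l =
  ((B.+1 - l)%:R / B.+1%:R) *: beta_poly B.+1 l.
Proof.
move=> lB; rewrite /beta_poly -scalerAr mulrCA -exprS scalerA subSn//.
congr (_ *: _); have B0 : B.+1%:R != 0 :> R by [].
apply/eqP; rewrite mulrAC -mulrA mulrC -mulrA.
rewrite -(inj_eq (mulfI B0)) mulrCA [_ * (_^-1 * _)]mulrA mulfV// mul1r.
rewrite -!natrM eqr_nat -!mulnA.
have := mul_bin_down B.+1 l; rewrite /= subSn// => e.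
by rewrite mulnCA e; apply/eqP; ring.
Qed.

End binomial_polynomials.

(** * Integrals of polynomials over the unit interval *)

Section polynomial_integrals.
Context (R : realType).
Notation mu := (@lebesgue_measure R).
Notation I01 := (`[0, 1]%classic : set R).
Implicit Types (F f g : {poly R}) (h : R -> R).

Lemma integrable_horner (a b : R) f : mu.-integrable `[a, b] (EFin \o horner f).
Proof.
apply: continuous_compact_integrable; first exact: segment_compact.
exact/continuous_subspaceT/continuous_horner.
Qed.

Lemma Rintegral_deriv_horner F (a b : R) : a <= b ->
  \int[mu]_(u in `[a, b]) F^`().[u] = F.[b] - F.[a].
Proof.
rewrite le_eqVlt => /predU1P[->|ab].
  by rewrite set_itv1 Rintegral_set1 subrr.
rewrite /Rintegral (@continuous_FTC2 _ _ (horner F))//.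
- exact/continuous_subspaceT/continuous_horner.
- split => [x _||]; first exact: derivable_horner.
  + by apply: cvg_at_right_filter; exact: continuous_horner.
  + by apply: cvg_at_left_filter; exact: continuous_horner.
- by move=> x _; rewrite derivE.
Qed.

(** The indicator truncates the integral at [p]. With [F] a binomial tail, this writes the tail at
    [p] as a truncated Beta integral over the fixed domain [0, 1], where sums over several [p] can
    be exchanged with it. *)
Lemma Rintegral_ltr_deriv_horner F (p : R) : 0 <= p <= 1 ->
  \int[mu]_(u in I01) ((u < p)%R%:R * F^`().[u]) = F.[p] - F.[0].
Proof.
move=> /andP[p0 p1]; rewrite -(Rintegral_deriv_horner F p0).
transitivity (\int[mu]_(u in I01 `&` `]-oo, p[) F^`().[u]).
  rewrite Rintegral_mkcondr; apply: eq_Rintegral => u _.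
  rewrite patchE; case: ifPn; rewrite ?inE ?notin_setE/= in_itv/=.
    by move=> ->; rewrite mul1r.
  by move=> /negP/negbTE ->; rewrite mul0r.
have -> : I01 `&` `]-oo, p[ = `[0, p[%classic.
  apply/seteqP; split => u /=; rewrite !in_itv/=.
    by move=> [/andP[-> _] ->].
  by move=> /andP[-> up]; rewrite up (ltW (lt_le_trans up p1)).
apply: Rintegral_itv_bndo_bndc.
apply: integrableS (integrable_horner 0 p F^`()) => //.
by apply: subset_itvl; rewrite bnd_simp.
Qed.

Lemma Rintegral_beta_poly B l : (0 < l <= B)%N ->
  \int[mu]_(u in I01) (beta_poly R B l).[u] = 1.
Proof.
move=> /andP[l0 lB].
have := Rintegral_deriv_horner (binom_tail R B l) ler01.
by rewrite deriv_binom_tail ?leqW// horner_binom_tail0// horner_binom_tail1// subr0.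
Qed.

Lemma integrable_bounded_horner h f (M : R) : measurable_fun I01 h ->
  (forall u, I01 u -> `|h u| <= M) ->
  mu.-integrable I01 (fun u => (h u * f.[u])%:E).
Proof.
move=> mh hM.
have := integrable_horner 0 1 f.
apply: integrableMr => //.
exists M; split; first by rewrite num_real.
by move=> N MN u uI /=; rewrite (le_trans (hM u uI))// ltW.
Qed.

(* Both integrals are weighted means of [h], so each lies between the bounds
   of [h] and their difference is at most its oscillation. *)
Lemma Rintegral_oscillation h f g (M k : R) : measurable_fun I01 h ->
  (forall u, I01 u -> `|h u| <= M) ->
  (forall u, I01 u -> 0 <= f.[u]) -> (forall u, I01 u -> 0 <= g.[u]) ->
  \int[mu]_(u in I01) f.[u] = 1 -> \int[mu]_(u in I01) g.[u] = 1 ->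
  (forall u v, I01 u -> I01 v -> `|h u - h v| <= k) ->
  `|\int[mu]_(u in I01) (h u * f.[u]) - \int[mu]_(u in I01) (h u * g.[u])| <= k.
Proof.
move=> mh hM.
have le_osc f1 g1 : (forall u, I01 u -> 0 <= f1.[u]) ->
  (forall u, I01 u -> 0 <= g1.[u]) ->
  \int[mu]_(u in I01) f1.[u] = 1 -> \int[mu]_(u in I01) g1.[u] = 1 ->
  (forall u v, I01 u -> I01 v -> `|h u - h v| <= k) ->
  \int[mu]_(u in I01) (h u * f1.[u]) <= \int[mu]_(u in I01) (h u * g1.[u]) + k.
  move=> f0 g0 f1E g1E hk.
  have cstE (c : R) (p : {poly R}) : \int[mu]_(u in I01) p.[u] = 1 ->
      \int[mu]_(u in I01) (c * p.[u]) = c.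
    by move=> pE; rewrite RintegralZl ?pE ?mulr1//; exact: integrable_horner.
  have int_cst (c : R) (p : {poly R}) : mu.-integrable I01 (fun u => (c * p.[u])%:E).
    by apply: (@integrable_bounded_horner (cst c) _ `|c|) => //.
  have int_h (p : {poly R}) := integrable_bounded_horner p mh hM.
  (* With [v] fixed, average [h u <= h v + k] over [u] against [f1]; the resulting bound is then
     averaged over [v] against [g1]. *)
  have lev v : I01 v -> \int[mu]_(u in I01) (h u * f1.[u]) <= h v + k.
    move=> vI; rewrite -[leRHS](cstE _ _ f1E); apply: le_Rintegral => //.
      exact: int_h.
      exact: int_cst.
    move=> u uI; rewrite ler_wpM2r ?f0//.
    by have := hk u v uI vI; rewrite ler_norml => /andP[_]; rewrite lerBlDl.
  rewrite -lerBlDr -[leLHS](cstE _ _ g1E); apply: le_Rintegral => //.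
    exact: int_cst.
    exact: int_h.
  by move=> v vI; rewrite ler_wpM2r ?g0// lerBlDr lev.
move=> f0 g0 f1 g1 hk; rewrite ler_norml lerBlDl le_osc// lerNl opprB lerBlDl.
by rewrite le_osc.
Qed.

(** * Comparison of a finite law on [0, 1] with the uniform law *)

Section discrete_distribution.
Context (I : finType) (q p : I -> R) (B : nat).
Hypothesis q_ge0 : forall i, 0 <= q i.
Hypothesis q_sum : \sum_i q i = 1.
Hypothesis p01 : forall i, 0 <= p i <= 1.

(* P(X > u) - P(V > u) for X of discrete law q on the points p and V uniform. *)
Let gap (u : R) : R := \sum_i q i * (u < p i)%R%:R - (1 - u).

Let measurable_ltr (c : R) : measurable_fun I01 (fun u : R => (u < c)%R%:R : R).
Proof.
have -> : (fun u : R => (u < c)%R%:R : R) = \1_`]-oo, c[.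
  apply/funext => u; rewrite indicE; congr (_ %:R); congr nat_of_bool.
  by apply/idP/idP; rewrite inE/= in_itv.
by apply: measurable_indic.
Qed.

Let measurable_gap : measurable_fun I01 gap.
Proof.
apply: measurable_funB; last by apply: measurable_funB => //.
apply: measurable_sum => i.
by apply: measurable_funM => //; exact: measurable_ltr.
Qed.

Let gap_bounded u : I01 u -> `|gap u| <= 2.
Proof.
rewrite /= in_itv/= => /andP[u0 u1].
have s0 : 0 <= \sum_i q i * (u < p i)%R%:R.
  by apply: sumr_ge0 => i _; rewrite mulr_ge0.
have s1 : \sum_i q i * (u < p i)%R%:R <= 1.
  rewrite -[leRHS]q_sum; apply: ler_sum => i _.
  by rewrite -[leRHS]mulr1 ler_wpM2l// lern1 leq_b1.
by rewrite /gap ler_norml; apply/andP; split; lra.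
Qed.

(** The strict inequality in [gap] turns its increments into masses of half-open intervals []s, t]],
    the intervals used by [dKS]. *)
Let gapB s t : s <= t ->
  gap s - gap t = \sum_(i | s < p i <= t) q i - (t - s).
Proof.
move=> st.
have -> : \sum_(i | s < p i <= t) q i =
  \sum_i q i * (s < p i)%R%:R - \sum_i q i * (t < p i)%R%:R.
  rewrite -sumrB big_mkcond/=; apply: eq_bigr => i _.
  have [/= sp|ps] := ltP s (p i); last by rewrite ltNge (le_trans ps st)/= subrr.
  by case: leP => tp; rewrite mulr1 ?mulr1 ?mulr0 ?subr0 ?subrr.
rewrite /gap; lra.
Qed.

(** Each atom [p i] contributes its binomial tail, after exchanging the finite sum with the
    integral; the uniform part [1 - u] contributes its Beta mean through [onem_beta_poly]. *)
Let Rintegral_gap l : (0 < l <= B)%N ->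
  \int[mu]_(u in I01) (gap u * (beta_poly R B l).[u]) =
  \sum_i q i * (binom_tail R B l).[p i] - (B.+1 - l)%:R / B.+1%:R.
Proof.
move=> /andP[l0 lB].
have mlt (c : R) := @measurable_ltr c.
have intl i : mu.-integrable I01
    (fun u => ((u < p i)%R%:R * (beta_poly R B l).[u])%:E).
  apply: (@integrable_bounded_horner (fun u => (u < p i)%R%:R) _ 1) => // u _.
  by rewrite ger0_norm// lern1 leq_b1.
transitivity (\int[mu]_(u in I01)
   (\sum_i q i * ((u < p i)%R%:R * (beta_poly R B l).[u])
    - ((B.+1 - l)%:R / B.+1%:R) * (beta_poly R B.+1 l).[u])).
  apply: eq_Rintegral => u _.
  rewrite -[X in _ = _ - X]hornerZ -onem_beta_poly// hornerM mulrBl mulr_suml.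
  rewrite hornerD hornerN hornerX hornerC; congr (_ - _).
  by apply: eq_bigr => i _; rewrite mulrA.
have int_q i : mu.-integrable I01
    (fun u => (q i * ((u < p i)%R%:R * (beta_poly R B l).[u]))%:E).
  exact: (@integrableZl _ _ _ mu _ _ (q i) _ (intl i)).
have int_sum (r : seq I) : mu.-integrable I01 (fun u =>
    (\sum_(i <- r) q i * ((u < p i)%R%:R * (beta_poly R B l).[u]))%:E).
  rewrite (_ : (fun u => _) = (fun u => (\sum_(i <- r)
      (q i * ((u < p i)%R%:R * (beta_poly R B l).[u]))%:E)%E)); last first.
    by apply/funext => u; rewrite sumEFin.
  by apply: integrable_sum => // i _; exact: int_q.
rewrite RintegralB//; last 2 first.
- exact: int_sum.
- apply: (@integrable_bounded_horner (cst ((B.+1 - l)%:R / B.+1%:R)) _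
    `|(B.+1 - l)%:R / B.+1%:R|) => //.
congr (_ - _).
  transitivity (\sum_i \int[mu]_(u in I01)
      (q i * ((u < p i)%R%:R * (beta_poly R B l).[u]))).
    elim: (index_enum I) => [|i r ih].
      under eq_Rintegral do rewrite big_nil.
      by rewrite big_nil Rintegral_cst// mul0r.
    under eq_Rintegral do rewrite big_cons.
    rewrite RintegralD//; last 2 first.
    - exact: int_q.
    - exact: int_sum.
    by rewrite big_cons ih.
  apply: eq_bigr => i _; rewrite RintegralZl//; last exact: intl.
  rewrite -deriv_binom_tail ?(leq_trans lB)// Rintegral_ltr_deriv_horner//.
  by rewrite horner_binom_tail0// subr0.
rewrite RintegralZl//; last exact: integrable_horner.
by rewrite Rintegral_beta_poly ?l0 ?leqW// mulr1.
Qed.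

(** The bound [e] is asked for [0 <= s <= t <= 1] only, where [t - s] is the uniform mass of []s,
    t]]. *)
Lemma binomial_interval_dKS l k (e : R) : (0 < l)%N -> (k + l <= B)%N ->
  (forall s t, 0 <= s -> s <= t -> t <= 1 ->
    `|\sum_(i | s < p i <= t) q i - (t - s)| <= e) ->
  `|\sum_i q i * \sum_(l <= n < k + l) (binom_poly R B n).[p i]
    - k%:R / B.+1%:R| <= e.
Proof.
move=> l0 klB he.
have lkl : (l <= k + l)%N by rewrite leq_addl.
have lB : (l <= B)%N by rewrite (leq_trans lkl).
have -> : \sum_i q i * \sum_(l <= n < k + l) (binom_poly R B n).[p i]
    - k%:R / B.+1%:R =
  \int[mu]_(u in I01) (gap u * (beta_poly R B l).[u])
  - \int[mu]_(u in I01) (gap u * (beta_poly R B (k + l)).[u]).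
  (* The two Beta means [(B + 1 - l) / (B + 1)] and [(B + 1 - k - l) / (B + 1)] differ by exactly
     [k / (B + 1)]. *)
  rewrite !Rintegral_gap ?l0 ?addn_gt0 ?l0 ?orbT//.
  under eq_bigr do rewrite -horner_binom_tailB ?lkl// mulrBr.
  rewrite sumrB !natrB ?leqW// natrD.
  by field.
apply: (Rintegral_oscillation measurable_gap gap_bounded).
- by move=> u uI; apply: beta_poly_ge0; move: uI; rewrite /= in_itv.
- by move=> u uI; apply: beta_poly_ge0; move: uI; rewrite /= in_itv.
- by apply: Rintegral_beta_poly; rewrite l0.
- by apply: Rintegral_beta_poly; rewrite addn_gt0 l0 orbT.
move=> u v; rewrite /= !in_itv/= => /andP[u0 u1] /andP[v0 v1].
case/orP: (le_total u v) => uv; first by rewrite gapB// he.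
by rewrite distrC gapB// he.
Qed.

End discrete_distribution.
End polynomial_integrals.

(** * Joint law of the data and the bootstrap samples *)

Section resampling.
Context d (T : measurableType d) (m : nat).

(* A bootstrap sample from [x] is [resample x k] for a uniformly random index
   map [k]. *)
Definition resample (x : m.-tuple T) (k : {ffun 'I_m -> 'I_m}) : m.-tuple T :=
  [tuple tnth x (k i) | i < m].

Lemma measurable_resample k : measurable_fun setT (resample ^~ k).
Proof.
apply/measurable_fun_tnthP => i.
rewrite (_ : _ \o _ = (@tnth m T)^~ (k i)); first exact: measurable_tnth.
by apply/funext => x /=; rewrite tnth_mktuple.
Qed.

Definition resamples B (x : m.-tuple T)
    (K : {ffun 'I_B -> {ffun 'I_m -> 'I_m}}) : B.-tuple (m.-tuple T) :=
  [tuple resample x (K b) | b < B].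

Lemma measurable_resamples B K : measurable_fun setT ((@resamples B) ^~ K).
Proof.
apply/measurable_fun_tnthP => b.
rewrite (_ : _ \o _ = resample ^~ (K b)); first exact: measurable_resample.
by apply/funext => x /=; rewrite tnth_mktuple.
Qed.

End resampling.

(** * Rectangles as a generating pi-system *)

Section rectangles.
Context d (T : measurableType d) (m B : nat).
Notation sample := (m.-tuple T).
Notation joint := (sample * B.-tuple sample)%type.

(** These are the events whose probability [bootstrap_samples] prescribes. They are closed under
    intersection and generate the product sigma-algebra, hence determine the joint law. *)
Definition rectangle (A : set sample) (C : 'I_B -> 'I_m -> set T) : set joint :=
  [set z | A z.1 /\ forall b i, C b i (tnth (tnth z.2 b) i)].

Definition rectangles : set (set joint) :=
  [set E | exists A C, [/\ measurable A, forall b i, measurable (C b i) &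
                           E = rectangle A C]].

Lemma rectanglesT : rectangles setT.
Proof.
exists setT, (fun _ _ => setT); split => //.
by apply/seteqP; split.
Qed.

Lemma rectangles_setI : setI_closed rectangles.
Proof.
move=> _ _ [A1 [C1 [mA1 mC1 ->]]] [A2 [C2 [mA2 mC2 ->]]].
exists (A1 `&` A2), (fun b i => C1 b i `&` C2 b i); split.
- exact: measurableI.
- by move=> b i; exact: measurableI.
- apply/seteqP; split => z /=.
    by move=> [[a1 c1] [a2 c2]]; split => // b i; split.
  by move=> [[a1 a2] c]; do 2 split => //; move=> b i; have [] := c b i.
Qed.

Lemma measurable_rectangle A C : measurable A ->
  (forall b i, measurable (C b i)) -> measurable (rectangle A C).
Proof.
move=> mA mC.
have -> : rectangle A C = fst @^-1` A `&`
    \bigcap_(b in [set: 'I_B]) \bigcap_(i in [set: 'I_m])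
      ((fun z : joint => tnth (tnth z.2 b) i) @^-1` C b i).
  apply/seteqP; split => z /=.
    by move=> [a c]; split => // b _ i _; exact: c.
  by move=> [a c]; split => // b i; exact: c.
apply: measurableI.
  by rewrite -[X in measurable X]setTI; exact: measurable_fst.
apply: fin_bigcap_measurable => // b _.
apply: fin_bigcap_measurable => // i _.
rewrite -[X in measurable X]setTI.
have mf : measurable_fun [set: joint] (fun z : joint => tnth (tnth z.2 b) i).
  apply: (measurableT_comp (@measurable_tnth _ T m i)).
  exact: (measurableT_comp (@measurable_tnth _ sample B b) measurable_snd).
exact: mf.
Qed.

(* The identity from the sigma-algebra generated by the rectangles to the
   product sigma-algebra is measurable, since all coordinates are. *)
Lemma measurable_rectangles : @measurable _ joint = <<s rectangles >>.
Proof.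
apply/seteqP; split; last first.
  apply: smallest_sub; first exact: sigma_algebra_measurable.
  by move=> _ [A [C [mA mC ->]]]; exact: measurable_rectangle.
pose G := g_sigma_algebraType rectangles.
suff mid : measurable_fun [set: G] (idfun : G -> joint).
  by move=> E mE; have := mid measurableT E mE; rewrite setTI.
apply/measurable_fun_pairP; split.
  move=> _ A mA; rewrite setTI; apply: sub_sigma_algebra.
  exists A, (fun _ _ => setT); split => //.
  by apply/seteqP; split => z //= [].
apply/measurable_fun_tnthP => b; apply/measurable_fun_tnthP => i.
move=> _ A mA; rewrite setTI; apply: sub_sigma_algebra.
exists setT, (fun b' i' => if (b' == b) && (i' == i) then A else setT); split => //.
  by move=> b' i'; case: ifP.
apply/seteqP; split => z /=.
  by move=> Az; split => // b' i'; case: ifP => // /andP[/eqP-> /eqP->].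
by move=> [_ /(_ b i)]; rewrite !eqxx.
Qed.

End rectangles.

Section bootstrap_joint_law.
Context d (Omega : measurableType d) (R : realType) (Pr : probability Omega R).
Context d' (T : measurableType d') (m B : nat) (m0 : (0 < m)%N).
Context (D : {RV Pr >-> m.-tuple T}) (Ds : 'I_B -> {RV Pr >-> m.-tuple T}).
Notation sample := (m.-tuple T).
Notation joint := (sample * B.-tuple sample)%type.
Notation idx := {ffun 'I_B -> {ffun 'I_m -> 'I_m}}.

(** The weight of one joint choice of [B] index maps from ['I_m] to itself. *)
Let c : R := ((m ^ m) ^ B)%:R^-1.

(** Each factor is an average over indices [j]; distributing the products over these sums yields one
    term per choice of an index for every pair [(b, i)], that is, per [K]. *)
Lemma prod_empirical (x : sample) (C : 'I_B -> 'I_m -> set T) :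
  (\prod_(b < B) \prod_(i < m) empirical R m0 x (C b i))%E =
  (c * \sum_(K : idx)
      \prod_(b < B) \prod_(i < m) \1_(C b i) (tnth x (K b i)))%:E.
Proof.
have empE A : empirical R m0 x A =
    (m%:R^-1 * \sum_(j < m) \1_A (tnth x j))%:E.
  rewrite /empirical EFinM -sumEFin; congr (_ * _)%E.
under eq_bigr do under eq_bigr do rewrite empE.
under eq_bigr do rewrite prodEFin.
rewrite prodEFin; congr (_%:E).
under eq_bigr do rewrite big_split/= prodr_const card_ord bigA_distr_bigA.
rewrite big_split/= prodr_const card_ord bigA_distr_bigA; congr (_ * _).
by rewrite /c !natrX !exprVn.
Qed.

Definition joint_sample (w : Omega) : joint := (D w, [tuple Ds b w | b < B]).

Lemma measurable_joint_sample : measurable_fun setT joint_sample.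
Proof.
apply: measurable_fun_pair => //; apply/measurable_fun_tnthP => b.
rewrite (_ : _ \o _ = Ds b)//.
by apply/funext => w /=; rewrite tnth_mktuple.
Qed.

Definition joint_resample (K : idx) (w : Omega) : joint :=
  (D w, resamples (D w) K).

Lemma measurable_joint_resample K : measurable_fun setT (joint_resample K).
Proof.
apply: measurable_fun_pair => //.
by apply: (measurableT_comp (measurable_resamples K)).
Qed.

HB.instance Definition _ :=
  isMeasurableFun.Build _ _ _ _ joint_sample measurable_joint_sample.
HB.instance Definition _ K :=
  isMeasurableFun.Build _ _ _ _ (joint_resample K) (measurable_joint_resample K).

Let rectangle_joint_resample A C K w :
  \1_(joint_resample K @^-1` rectangle A C) w =
  \1_(D @^-1` A) w * \prod_(b < B) \prod_(i < m) \1_(C b i) (tnth (D w) (K b i)) :> R.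
Proof.
rewrite !indicE /=.
have [Aw|Aw] := pselect (A (D w)); last first.
  rewrite [w \in D @^-1` A]memNset// mul0r memNset//=.
  by move=> [].
rewrite [w \in D @^-1` A]mem_set// mul1r.
have [Cw|Cw] := pselect (forall b i, C b i (tnth (D w) (K b i))).
  rewrite mem_set/=; last by split => // b i; rewrite !tnth_mktuple.
  rewrite big1// => b _; rewrite big1// => i _.
  by rewrite indicE mem_set.
rewrite memNset/=; last first.
  by move=> [_ CK]; apply: Cw => b i; have := CK b i; rewrite !tnth_mktuple.
move/existsNP : Cw => [b /existsNP[i CN]].
by rewrite (bigD1 b)//= (bigD1 i)//= indicE memNset// !mul0r.
Qed.

(** The right side, a uniform mixture of the laws of [joint_resample K], is itself a measure. It
    agrees with the joint law on rectangles by [prod_empirical], hence everywhere by uniqueness of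
    measures. *)
Lemma bootstrap_joint_law : bootstrap_samples Pr m0 D Ds ->
  forall E : set joint, measurable E ->
  Pr (joint_sample @^-1` E) =
  (c%:E * \sum_(K : idx) Pr (joint_resample K @^-1` E))%E.
Proof.
move=> boot.
have c0 : 0 <= c by rewrite invr_ge0.
(* [K0] only serves as the default of [nth]: [msum] takes a sequence of measures indexed by
   [nat]. *)
pose K0 : idx := [ffun=> [ffun=> Ordinal m0]].
pose mu (n : nat) : {measure set joint -> \bar R} :=
  distribution Pr (joint_resample (nth K0 (index_enum idx) n)).
pose m2 : {measure set joint -> \bar R} :=
  mscale (NngNum c0) (msum mu (size (index_enum idx))).
have m2E E : m2 E = (c%:E * \sum_(K : idx) Pr (joint_resample K @^-1` E))%E.
  rewrite /m2 /mscale /msum /=; congr (_ * _)%E.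
  by rewrite (big_nth K0) big_mkord.
move=> E mE; rewrite -m2E.
have := @measure_unique _ R joint (@rectangles _ T m B) (fun=> setT)
  (@measurable_rectangles _ T m B) (@rectangles_setI _ T m B)
  (fun=> @rectanglesT _ T m B) _ (distribution Pr joint_sample) m2.
apply => //.
- by rewrite bigcup_const//; exists 0%N.
- move=> _ [A [C [mA mC ->]]]; rewrite m2E.
  transitivity (Pr (D @^-1` A `&` [set w | forall b i, C b i (tnth (Ds b w) i)])).
    congr (Pr _); apply/seteqP; split => w /=.
      by move=> [a h]; split => // b i; have := h b i; rewrite tnth_mktuple.
    by move=> [a h]; split => // b i; rewrite tnth_mktuple.
  rewrite boot//.
  under eq_integral do rewrite prod_empirical.
  have mDA : measurable (D @^-1` A).
    by rewrite -[X in measurable X]setTI; exact: measurable_funP.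
  have mK K : measurable (joint_resample K @^-1` rectangle A C).
    rewrite -[X in measurable X]setTI; apply: measurable_joint_resample => //.
    exact: measurable_rectangle.
  rewrite integral_mkcond.
  transitivity (\int[Pr]_w (c%:E * \sum_(K : idx)
      (\1_(joint_resample K @^-1` rectangle A C) w)%:E))%E.
    apply: eq_integral => w _.
    under [in RHS]eq_bigr do rewrite rectangle_joint_resample.
    rewrite patchE; case: ifPn => wA.
      rewrite EFinM -sumEFin; congr (_ * _)%E; apply: eq_bigr => K _.
      by rewrite [in RHS]indicE wA mul1r.
    rewrite big1 ?mule0// => K _.
    by rewrite [in LHS]indicE (negbTE wA) mul0r.
  rewrite ge0_integralZl//; last 2 first.
  - apply: emeasurable_sum => K; apply/measurable_EFinP.
    exact: measurable_indic.
  - by move=> w _; apply: sume_ge0 => K _; rewrite lee_fin.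
  congr (_ * _)%E; rewrite ge0_integral_sum//.
  + by apply: eq_bigr => K _; rewrite integral_indic// setIT.
  + by move=> K; apply/measurable_EFinP; exact: measurable_indic.
- by move=> _; rewrite (le_lt_trans (probability_le1 _ _))// ltry.
Qed.

End bootstrap_joint_law.

(** * The conditional binomial law *)

Section counting.
Context (J : finType) (A : {pred J}) (B : nat).
Implicit Types K : {ffun 'I_B -> J}.

(** The values of [K] are chosen independently: in [A] at the points of [Z], outside [A]
    elsewhere. *)
Lemma card_ffun_preimset (Z : {set 'I_B}) :
  #|[pred K : {ffun 'I_B -> J} | [set b | K b \in A]%SET == Z]| =
  (#|A| ^ #|Z| * #|predC A| ^ #|~: Z|)%N.
Proof.
pose F (b : 'I_B) := [pred j | (j \in A) == (b \in Z)].
transitivity #|(family F : simpl_pred {ffun 'I_B -> J})|.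
  apply: eq_card => K; rewrite [LHS]inE; apply/eqP/familyP => [ZE b|KF].
    by rewrite inE -ZE inE.
  by apply/setP => b; rewrite inE; have /eqP := KF b.
rewrite card_family foldrE big_image/=.
rewrite (bigID (mem Z))/=; congr muln.
  rewrite -prod_nat_const; apply: eq_bigr => b bZ.
  by apply: eq_card => j; rewrite -[LHS]/((j \in A) == (b \in Z)) bZ eqb_id.
rewrite -prod_nat_const; apply: eq_big => [b|b bZ]; first by rewrite inE.
by apply: eq_card => j; rewrite -[LHS]/((j \in A) == (b \in Z)) (negbTE bZ) eqbF_neg.
Qed.

(** Partition the maps by the set [Z] of points sent into [A]; there are ['C(B, n)] sets of size
    [n], all with equally many maps. *)
Lemma card_ffun_count (n : nat) :
  #|[pred K : {ffun 'I_B -> J} | #|[pred b | K b \in A]| == n]| =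
  ('C(B, n) * (#|A| ^ n * #|predC A| ^ (B - n)))%N.
Proof.
have cardE K : #|[pred b | K b \in A]| = #|[set b | K b \in A]%SET|.
  by apply: eq_card => b; rewrite inE.
rewrite -[LHS]sum1_card
  (partition_big (fun K : {ffun 'I_B -> J} => [set b | K b \in A]%SET)
  (fun Z : {set 'I_B} => #|Z| == n))/=; last first.
  by move=> K; rewrite inE cardE.
transitivity (\sum_(Z : {set 'I_B} | #|Z| == n)
    (#|A| ^ n * #|predC A| ^ (B - n)))%N.
  apply: eq_bigr => Z /eqP Zn.
  have -> : (B - n)%N = #|~: Z| by rewrite [RHS]cardsCs finset.setCK card_ord Zn.
  rewrite -[in RHS]Zn.
  rewrite -card_ffun_preimset -[RHS]sum1_card.
  apply: eq_bigl => K; rewrite !inE cardE.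
  by rewrite andbC; case: eqP => //= ->; rewrite Zn eqxx.
rewrite sum_nat_const; congr muln.
by rewrite -[in RHS](card_ord B) -card_draws; apply: eq_card => Z; rewrite !inE.
Qed.

(** For [K] uniform, the number of values in [A] is binomial with success probability
    [#|A| / #|J|]. *)
Lemma card_ffun_count_itv (R : realType) l r : (0 < #|J|)%N ->
  \sum_(K : {ffun 'I_B -> J})
    ((l <= #|[pred b | K b \in A]| < r)%N)%:R / (#|J| ^ B)%:R
  = \sum_(l <= n < r) (binom_poly R B n).[#|A|%:R / #|J|%:R].
Proof.
move=> J0; have JR0 : #|J|%:R != 0 :> R by rewrite pnatr_eq0 -lt0n.
transitivity (\sum_(l <= n < r) \sum_(K : {ffun 'I_B -> J})
    (#|[pred b | K b \in A]| == n)%:R / (#|J| ^ B)%:R : R).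
  rewrite exchange_big/=; apply: eq_bigr => K _.
  rewrite -mulr_suml; congr (_ / _); rewrite -natr_sum; congr (_%:R).
  set c := #|_|.
  have [/andP[lc cr]|] := boolP (l <= c < r)%N.
    rewrite (bigD1_seq c) ?mem_index_iota ?lc ?iota_uniq//= eqxx big1// => n.
    by rewrite eq_sym => /negbTE ->.
  move=> cN; rewrite big_seq big1// => n; rewrite mem_index_iota => nI.
  by case: eqP => // cn; rewrite cn nI in cN.
apply: eq_bigr => n _.
rewrite -mulr_suml -natr_sum.
(* Since [r] is arbitrary, [n] may exceed [B]; then no map has that count and ['C(B, n)] is 0. *)
have [Bn|nB] := ltnP B n.
  rewrite horner_binom_poly bin_small// mul0r big1 ?mul0r// => K _.
  apply/eqP; rewrite eqb0; apply/eqP => cn; move: Bn; rewrite -cn ltnNge.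
  by rewrite (leq_trans (max_card _))// card_ord.
have -> : (\sum_(K : {ffun 'I_B -> J}) (#|[pred b | K b \in A]| == n))%N =
   ('C(B, n) * (#|A| ^ n * #|predC A| ^ (B - n)))%N.
  rewrite -card_ffun_count -[RHS]sum1_card [RHS]big_mkcond/=.
  by apply: eq_bigr => K _; rewrite inE; case: eqP.
rewrite horner_binom_poly.
have -> : 1 - #|A|%:R / #|J|%:R = #|predC A|%:R / #|J|%:R :> R.
  by rewrite -(cardC A) natrD -[X in X - _](@mulfV _ (#|A|%:R + #|predC A|%:R)) ?mulrDl;
    [rewrite addrAC subrr add0r | rewrite -natrD cardC].
rewrite !exprMn -!mulrA; rewrite !natrM !natrX -mulrA; congr (_ * _).
rewrite -[in LHS](subnKC nB) exprD !exprVn invfM.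
by rewrite addKn -!mulrA; congr (_ * _); rewrite mulrCA.
Qed.

End counting.

(** The event is a finite union, over the sets [S] accepted by [Q], of finite intersections that fix
    every predicate [p i]. *)
Lemma measurable_set_of_pred d (Z : measurableType d) (I : finType)
    (Q : {set I} -> bool) (p : I -> Z -> bool) :
  (forall i, measurable [set z | p i z]) ->
  measurable [set z | Q [set i | p i z]%SET].
Proof.
move=> mp.
have -> : [set z | Q [set i | p i z]%SET] = \bigcup_(S in [set S | Q S])
    \bigcap_(i in [set: I]) [set z | p i z = (i \in S)].
  apply/seteqP; split => z /=.
    by move=> Qz; exists [set i | p i z]%SET => //= i _; rewrite inE.
  move=> [S /= QS Sz]; rewrite (_ : [set i | p i z]%SET = S)//.
  by apply/setP => i; rewrite inE Sz.
apply: fin_bigcup_measurable => // S _; apply: fin_bigcap_measurable => // i _.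
case: (i \in S); first exact: mp.
have -> : [set z | p i z = false] = ~` [set z | p i z].
  by apply/seteqP; split => z /=; [move=> ->|move/negP/negbTE].
exact/measurableC/mp.
Qed.

Lemma integral_sum_indic d (Omega : measurableType d) (R : realType)
    (mu : {measure set Omega -> \bar R}) (V : set Omega) (I : finType)
    (a : I -> R) (A : I -> set Omega) :
  measurable V -> (forall i, 0 <= a i) -> (forall i, measurable (A i)) ->
  (\int[mu]_(w in V) (\sum_i a i * \1_(A i) w)%:E =
   \sum_i (a i)%:E * mu (A i `&` V))%E.
Proof.
move=> mV a0 mA.
have mI i : measurable_fun V (fun w => (\1_(A i) w : R)%:E).
  by apply/measurable_EFinP; exact: measurable_indic.
under eq_integral do rewrite -sumEFin.
rewrite ge0_integral_sum//; last 2 first.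
- by move=> i; apply/measurable_EFinP/measurable_funM => //; exact: measurable_indic.
- by move=> i w _; rewrite lee_fin mulr_ge0.
apply: eq_bigr => i _; under eq_integral do rewrite EFinM.
by rewrite ge0_integralZl ?lee_fin// ?integral_indic// => w _; rewrite lee_fin.
Qed.

Lemma measurable_rVP d (Z : measurableType d) (R : realType) n
    (f : Z -> 'rV[R]_n) :
  measurable_fun setT f <->
  forall i, measurable_fun setT (fun z => f z ord0 i : measurableTypeR R).
Proof.
pose coord (i : 'I_n) (v : 'rV[R]_n) : measurableTypeR R := v ord0 i.
split=> [mf i|mf].
  have mc : measurable_fun setT (coord i).
    move=> _ A mA; rewrite setTI; apply: sub_sigma_algebra; rewrite -bigcup_seq/=.
    exists i; first by rewrite /= mem_index_enum.
    by exists A => //; rewrite setTI.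
  exact: (measurableT_comp mc mf).
apply: (@measurability _ _ _ _ _ _
  (\big[setU/set0]_(i < n) preimage_set_system setT (coord i) measurable)) => //.
move=> _ [E + <-]; rewrite -bigcup_seq/= => -[i _ [A mA <-]].
by rewrite setTI; exact: mf.
Qed.

(** One coordinate of a uniform map is uniform. Multiplying by [#|J|] avoids the exponent
    [#|I| - 1]. *)
Lemma card_ffun_eval (I J : finType) (A : {pred J}) (b : I) :
  (#|[pred K : {ffun I -> J} | K b \in A]| * #|J| = #|A| * #|J| ^ #|I|)%N.
Proof.
pose F (c : I) := [pred j | (c == b) ==> (j \in A)].
have -> : #|[pred K : {ffun I -> J} | K b \in A]| =
    #|(family F : simpl_pred {ffun I -> J})|.
  apply: eq_card => K; rewrite [LHS]inE; apply/idP/familyP => [Kb c|/(_ b)].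
    by rewrite inE; apply/implyP => /eqP ->.
  by rewrite inE eqxx.
rewrite card_family foldrE big_image/= (bigD1 b)//= -mulnA; congr muln.
  by apply: eq_card => j; rewrite -[LHS]/((b == b) ==> (j \in A)) eqxx.
under eq_bigr => c cb.
  rewrite (_ : #|F c| = #|J|); first by over.
  by apply: eq_card => j; rewrite -[LHS]/((c == b) ==> (j \in A)) (negbTE cb).
by rewrite prod_nat_const cardC1 -expnSr prednK// (cardD1 b).
Qed.

(** * Binomial law of the bootstrap count given the data *)

Section conditional_binomial.
Context d (Omega : measurableType d) (R : realType) (Pr : probability Omega R).
Context d' (T : measurableType d') (m B : nat) (m0 : (0 < m)%N).
Context (D : {RV Pr >-> m.-tuple T}) (Ds : 'I_B -> {RV Pr >-> m.-tuple T}).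
Context (s : m.-tuple T -> m.-tuple T -> R) (t : m.-tuple T -> R).
Notation sample := (m.-tuple T).
Notation joint := (sample * B.-tuple sample)%type.
Notation J := {ffun 'I_m -> 'I_m}.
Notation idx := {ffun 'I_B -> J}.
Hypothesis ms : measurable_fun setT (fun z : sample * sample => s z.1 z.2).
Hypothesis mt : measurable_fun setT t.
Hypothesis boot : bootstrap_samples Pr m0 D Ds.

(** Given [D = x], a bootstrap statistic is at most [t x] exactly when its index map is good, so
    [#|good x| / #|J|] is the conditional probability called F0. *)
Definition good (x : sample) : {pred J} := [pred k | s x (resample x k) <= t x].

Definition below (z : joint) : {pred 'I_B} := [pred b | s z.1 (tnth z.2 b) <= t z.1].

Let measurable_good k : measurable [set x | k \in good x].
Proof.
have := @measurable_fun_le _ _ R setT (fun x => s x (resample x k)) t.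
rewrite setTI; apply => //.
have mp : measurable_fun setT (fun x : sample => (x, resample x k)).
  by apply: measurable_fun_pair => //; exact: measurable_resample.
exact: (measurableT_comp ms mp).
Qed.

Let measurable_below b : measurable [set z | b \in below z].
Proof.
have := @measurable_fun_le _ _ R setT (fun z : joint => s z.1 (tnth z.2 b))
  (t \o fst).
rewrite setTI; apply => //; last exact: measurableT_comp.
have mp : measurable_fun setT (fun z : joint => (z.1, tnth z.2 b)).
  apply: measurable_fun_pair => //.
  exact: (measurableT_comp (@measurable_tnth _ sample B b) measurable_snd).
exact: (measurableT_comp ms mp).
Qed.

Lemma measurable_card_good (Q : nat -> bool) : measurable [set x | Q #|good x|].
Proof.
have -> : [set x | Q #|good x|] = [set x | Q #|[set k | k \in good x]%SET|].
  apply/seteqP; split => x /=.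
    by congr (is_true (Q _)); apply: eq_card => k; rewrite inE.
  by congr (is_true (Q _)); apply: eq_card => k; rewrite [LHS]inE.
exact: (@measurable_set_of_pred _ _ _ (fun Z => Q #|Z|) (fun k x => k \in good x)).
Qed.

Lemma measurable_card_below (Q : nat -> bool) : measurable [set z | Q #|below z|].
Proof.
have -> : [set z | Q #|below z|] = [set z | Q #|[set b | b \in below z]%SET|].
  apply/seteqP; split => z /=.
    by congr (is_true (Q _)); apply: eq_card => b; rewrite inE.
  by congr (is_true (Q _)); apply: eq_card => b; rewrite [LHS]inE.
exact: (@measurable_set_of_pred _ _ _ (fun Z => Q #|Z|) (fun b z => b \in below z)).
Qed.

Let card_J : #|{: J}| = (m ^ m)%N.
Proof. by rewrite card_ffun !card_ord. Qed.

Let J_gt0 : (0 < #|{: J}|)%N.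
Proof. by rewrite card_J expn_gt0 m0. Qed.

Let in_below x (K : idx) b : (b \in below (x, resamples x K)) = (K b \in good x).
Proof. by rewrite !inE/= tnth_mktuple. Qed.

Let measurableD_preimage (A : set sample) : measurable A -> measurable (D @^-1` A).
Proof. by move=> mA; rewrite -[X in measurable X]setTI; exact: measurable_funP. Qed.

Let joint_preimage K (E : set joint) : measurable E ->
  measurable (joint_resample D K @^-1` E).
Proof.
by move=> mE; rewrite -[X in measurable X]setTI; apply: measurable_joint_resample.
Qed.

Let c : R := ((m ^ m) ^ B)%:R^-1.

Let c_ge0 : 0 <= c. Proof. by rewrite invr_ge0. Qed.

(** This is conditioning on [D]: the integrand is the fraction of index maps that realize [E].
    Taking [V] full gives the law of the count; general [V] identifies conditional probabilities. *)
Let joint_law_integral (V : set sample) (E : set joint) :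
  measurable V -> measurable E ->
  Pr (joint_sample D Ds @^-1` ((fst @^-1` V) `&` E)) =
  (\int[Pr]_(w in D @^-1` V)
     (\sum_(K : idx) c * \1_(joint_resample D K @^-1` E) w)%:E)%E.
Proof.
move=> mV mE; rewrite integral_sum_indic//; last 2 first.
- exact: measurableD_preimage.
- by move=> K; exact: joint_preimage.
have mVE : measurable ((fst @^-1` V) `&` E).
  by apply: measurableI => //; rewrite -[X in measurable X]setTI; exact: measurable_fst.
rewrite (bootstrap_joint_law boot mVE) ge0_sume_distrr//.
by apply: eq_bigr => K _; rewrite setIC.
Qed.

(** The conditional probability takes finitely many values [good_freq g]; [good_law] gives their
    masses, as needed by [binomial_interval_dKS]. *)
Definition good_law (g : 'I_#|{: J}|.+1) : R :=
  fine (Pr [set w | #|good (D w)| == g]).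

Definition good_freq (g : nat) : R := g%:R / #|{: J}|%:R.

Lemma good_freq01 (g : 'I_#|{: J}|.+1) : 0 <= good_freq g <= 1.
Proof.
rewrite /good_freq divr_ge0//= ler_pdivrMr ?ltr0n// mul1r ler_nat.
by rewrite -ltnS ltn_ord.
Qed.

Let measurable_good_eq (g : nat) : measurable [set w | #|good (D w)| == g].
Proof.
rewrite (_ : [set w | _] = D @^-1` [set x | #|good x| == g])//.
exact: measurableD_preimage (measurable_card_good (fun n => n == g)).
Qed.

Let good_ord w : (#|good (D w)| < #|{: J}|.+1)%N.
Proof. by rewrite ltnS max_card. Qed.

Let sum_good (F : nat -> R) w :
  \sum_(g < #|{: J}|.+1) F g * \1_[set w | #|good (D w)| == g] w =
  F #|good (D w)|.
Proof.
rewrite (bigD1 (Ordinal (good_ord w)))//= indicE mem_set//= mulr1.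
rewrite big1 ?addr0// => g gN; rewrite indicE memNset ?mulr0//=.
by move=> /eqP e; move: gN; rewrite -val_eqE/= e eqxx.
Qed.

Lemma good_law_ge0 g : 0 <= good_law g.
Proof. by rewrite fine_ge0. Qed.

Let good_lawE g : (good_law g)%:E = Pr [set w | #|good (D w)| == g].
Proof. by rewrite fineK// fin_num_measure. Qed.

Lemma good_law_sum1 : \sum_g good_law g = 1.
Proof.
apply: EFin_inj; rewrite -sumEFin -(probability_setT Pr).
transitivity (\int[Pr]_(w in setT) (\sum_(g < #|{: J}|.+1)
    1 * \1_[set w | #|good (D w)| == g] w)%:E)%E.
  rewrite integral_sum_indic//.
  by apply: eq_bigr => g _; rewrite mul1e setIT good_lawE.
under eq_integral do rewrite (sum_good (fun=> 1)).
by rewrite integral_cst// mul1e.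
Qed.

(** Given [D], the count is binomial by [card_ffun_count_itv], with a parameter depending on [D]
    only through [#|good (D w)|]; the integral is then grouped by the value of that number. *)
Lemma card_below_law l r :
  fine (Pr (joint_sample D Ds @^-1` [set z | l <= #|below z| < r])%N) =
  \sum_g good_law g * \sum_(l <= n < r) (binom_poly R B n).[good_freq g].
Proof.
pose E := [set z : joint | (l <= #|below z| < r)%N].
have mE : measurable E := measurable_card_below (fun n => l <= n < r)%N.
have := joint_law_integral (@measurableT _ sample) mE.
rewrite setTI preimage_setT => ->.
pose h g := \sum_(l <= n < r) (binom_poly R B n).[good_freq g].
have h0 (g : 'I_#|{: J}|.+1) : 0 <= h g.
  apply: sumr_ge0 => n _; rewrite horner_binom_poly.
  have /andP[f0 f1] := good_freq01 g.
  by rewrite !mulr_ge0// exprn_ge0// subr_ge0.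
transitivity (fine (\int[Pr]_(w in setT) (\sum_(g < #|{: J}|.+1)
    h g * \1_[set w | #|good (D w)| == g] w)%:E)%E).
  congr fine; apply: eq_integral => w _; congr (_%:E).
  rewrite sum_good /h /good_freq -card_ffun_count_itv//.
  apply: eq_bigr => K _; rewrite mulrC card_J; congr (_ / _).
  rewrite indicE; congr (_%:R); apply: congr1.
  have -> : #|[pred b | K b \in good (D w)]| = #|below (joint_resample D K w)|.
    by apply: eq_card => b; rewrite in_below.
  by apply/idP/idP; rewrite inE.
rewrite integral_sum_indic//.
transitivity (fine (\sum_g (good_law g * h g)%:E)%E); last by rewrite sumEFin.
by congr fine; apply: eq_bigr => g _; rewrite setIT mulrC EFinM good_lawE.
Qed.

Let freq (x : sample) : R := good_freq #|good x|.

Let measurable_freq : measurable_fun setT freq.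
Proof.
move=> _ Y mY; rewrite setTI.
have -> : freq @^-1` Y = [set x | `[< Y (good_freq #|good x|) >]].
  by apply/seteqP; split => x /= /asboolP.
exact: (measurable_card_good (fun g => `[< Y (good_freq g) >])).
Qed.

(** The [b]-th index map alone is uniform by [card_ffun_eval], so [freq] satisfies the defining
    identity of the conditional probability. *)
Let integral_freq b (V : set sample) : measurable V ->
  Pr (joint_sample D Ds @^-1` ((fst @^-1` V) `&` [set z | b \in below z])) =
  (\int[Pr]_(w in D @^-1` V) (freq (D w))%:E)%E.
Proof.
move=> mV; rewrite joint_law_integral//.
apply: eq_integral => w _; congr (_%:E); rewrite -mulr_sumr.
have -> : \sum_(K : idx) \1_(joint_resample D K @^-1` [set z | b \in below z]) w =
    #|[pred K : idx | K b \in good (D w)]|%:R :> R.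
  rewrite -sum1_card natr_sum [RHS]big_mkcond/=; apply: eq_bigr => K _.
  rewrite indicE [in RHS]inE -in_below.
  by case: ifPn => h; [rewrite mem_set|rewrite memNset//=; exact/negP].
have := card_ffun_eval (good (D w)) b; rewrite card_ord card_J => h.
rewrite /freq /good_freq card_J /c; apply/eqP.
have p0 : (m ^ m)%:R != 0 :> R by rewrite pnatr_eq0 -lt0n expn_gt0 m0.
have q0 : ((m ^ m) ^ B)%:R != 0 :> R.
  by rewrite pnatr_eq0 -lt0n !expn_gt0 m0.
by rewrite [X in X == _]mulrC eqr_div// -!natrM h.
Qed.

(** * The law of the conditional probability *)

Section conditional_probability.
Context (F0 : {mfun sample >-> R}) (b : 'I_B).
Hypothesis F0_version : cond_prob_version Pr D
  (joint_sample D Ds @^-1` [set z | b \in below z]) F0.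

(** [F0] and [freq] have equal integrals over every event of [D], so they agree almost everywhere
    under the law of [D] and have the same image law. *)
Lemma cond_prob_law (Y : set R) : measurable Y ->
  distribution Pr (F0 \o D) Y = distribution Pr D (freq @^-1` Y).
Proof.
move=> mY; have [F0i F0E] := F0_version.
pose mu := distribution Pr D.
have mF0 : measurable_fun setT (EFin \o F0) by apply/measurable_EFinP.
have mfr : measurable_fun setT (EFin \o freq) by apply/measurable_EFinP.
have ae : ae_eq mu setT (EFin \o F0) (EFin \o freq).
  apply: integral_ae_eq => //.
    by apply: integrable_pushforward.
  move=> V _ mV; rewrite integral_pushforward//; last first.
    by apply: integrableS F0i => //; exact: measurableD_preimage.
  rewrite ge0_integral_pushforward//; last 2 first.
  - exact: measurable_funTS.
  - by move=> x _; rewrite lee_fin divr_ge0.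
  by rewrite [LHS]F0E// -[RHS](integral_freq b mV).
pose N := [set x | (F0 x)%:E != (freq x)%:E].
have mN : measurable N.
  have := measurable_neqe measurableT mF0 mfr.
  by rewrite setTI.
have N0 : mu N = 0%E.
  apply: measure_negligible => //; apply: negligibleS ae => x /= /eqP xN h.
  exact: xN (h I).
have mpre (f : sample -> R) : measurable_fun setT f -> measurable (f @^-1` Y).
  by move=> mf; rewrite -[X in measurable X]setTI; exact: mf.
(* Adding the null set [N] where the two versions differ leaves the measures unchanged and makes the
   two preimages equal. *)
rewrite -[RHS](measureU0 (mpre _ measurable_freq) mN N0).
rewrite -[LHS]/(mu (F0 @^-1` Y)).
rewrite -[LHS](measureU0 (mpre F0 (measurable_funP F0)) mN N0).
congr (mu _); apply/seteqP; split => x /=.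
all: by have [[->]|] := eqVneq (F0 x)%:E (freq x)%:E; [tauto|right].
Qed.

Lemma cond_prob_itv (u v : R) :
  fine (distribution Pr (F0 \o D) `]u, v]%classic) =
  \sum_(g | u < good_freq (nat_of_ord g) <= v) good_law g.
Proof.
rewrite cond_prob_law//.
transitivity (fine (\int[Pr]_(w in setT) (\sum_(g < #|{: J}|.+1)
    (u < good_freq g <= v)%R%:R * \1_[set w | #|good (D w)| == g] w)%:E)%E).
  congr fine.
  under eq_integral do rewrite (sum_good (fun g => (u < good_freq g <= v)%R%:R)).
  transitivity (\int[Pr]_(w in setT) (\1_(D @^-1` (freq @^-1` `]u, v]%classic)) w)%:E)%E.
    rewrite integral_indic ?setIT//; apply: measurableD_preimage.
    by rewrite -[X in measurable X]setTI; exact: measurable_freq.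
  apply: eq_integral => w _; congr (_%:E); rewrite indicE; congr (_%:R).
  apply: congr1.
  by apply/idP/idP; rewrite inE/= in_itv.
rewrite integral_sum_indic// [in RHS]big_mkcond/=.
rewrite -[RHS]/(fine _%:E) -sumEFin; congr fine; apply: eq_bigr => g _.
by rewrite setIT -good_lawE; case: ifP; rewrite ?mul1e ?mul0e.
Qed.

End conditional_probability.
End conditional_binomial.

(** * The coverage bound *)

Lemma ler_dist_mix (R : realDomainType) (v y y' z z' e : R) :
  0 <= v <= 1 -> `|y - y'| <= e -> `|z - z'| <= e ->
  `|v * y + (1 - v) * z - (v * y' + (1 - v) * z')| <= e.
Proof.
move=> /andP[v0 v1] ye ze; rewrite opprD addrACA -!mulrBr.
have -> : e = v * e + (1 - v) * e by ring.
have v1' : 0 <= 1 - v by rewrite subr_ge0.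
rewrite (le_trans (ler_normD _ _))// !normrM (ger0_norm v0) (ger0_norm v1').
by rewrite lerD// ler_wpM2l.
Qed.

(** Masses in [0, 1] bound the set by 1, so that its [sup] is a genuine upper bound. *)
Lemma dKS_ge (R : realType) (mu nu : set R -> \bar R) (u v : R) :
  (forall s t, 0 <= fine (mu `]s, t]%classic) <= 1) ->
  (forall s t, 0 <= fine (nu `]s, t]%classic) <= 1) ->
  `|fine (mu `]u, v]%classic) - fine (nu `]u, v]%classic)| <= dKS mu nu.
Proof.
move=> mu01 nu01; apply: ub_le_sup; last by exists u, v.
exists 1 => _ [s [t ->]].
have /andP[a0 a1] := mu01 s t; have /andP[b0 b1] := nu01 s t.
by rewrite ler_norml; apply/andP; split; lra.
Qed.

Lemma fine_probability01 d (T : measurableType d) (R : realType)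
    (P : probability T R) (A : set T) : measurable A -> 0 <= fine (P A) <= 1.
Proof.
move=> mA; rewrite fine_ge0//= -lee_fin fineK ?fin_num_measure//.
exact: probability_le1.
Qed.

Lemma uniform_prob01E (R : realType) (V : set R) : measurable V ->
  uniform_prob (@ltr01 R) V = lebesgue_measure (V `&` `[0, 1]).
Proof.
move=> mV; rewrite /uniform_prob integral_uniform_pdf.
rewrite -[RHS]mul1e -integral_cst; last exact: measurableI.
apply: eq_integral => x; rewrite inE => -[_]; rewrite /= in_itv/= => x01.
by rewrite /uniform_pdf x01 subr0 invr1.
Qed.

Lemma uniform_prob01_itvoc (R : realType) (u v : R) : 0 <= u -> u <= v -> v <= 1 ->
  uniform_prob (@ltr01 R) `]u, v] = (v - u)%:E.
Proof.
move=> u0 uv v1; rewrite uniform_prob01E//.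
rewrite setIidl; last first.
  move=> x /=; rewrite !in_itv/= => /andP[ux xv].
  by rewrite (le_trans u0 (ltW ux)) (le_trans xv v1).
rewrite lebesgue_measure_itv/= lte_fin.
by move: uv; rewrite le_eqVlt => /predU1P[->|->]; rewrite ?ltxx ?subrr// EFinB.
Qed.

Lemma uniform_prob01_itvNy (R : realType) (v : R) : 0 <= v <= 1 ->
  uniform_prob (@ltr01 R) `]-oo, v] = v%:E.
Proof.
move=> /andP[v0 v1]; rewrite uniform_prob01E//.
have -> : `]-oo, v] `&` `[0, 1] = `[0, v]%classic.
  apply/seteqP; split => x /=; rewrite !in_itv/=.
    by move=> [xv /andP[-> _]].
  by move=> /andP[x0 xv]; rewrite xv x0 (le_trans xv v1).
rewrite lebesgue_measure_itv/= lte_fin.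
by move: v0; rewrite le_eqVlt => /predU1P[<-|->]; rewrite ?ltxx// sube0.
Qed.

(** Split on the event [U <= v], of probability [v] because [U] is uniform; independence of [U] and
    [X] factors both pieces. *)
Lemma randomized_prob d (Omega : measurableType d) (R : realType)
    (Pr : probability Omega R) d' (Y : measurableType d')
    (U : {RV Pr >-> R}) (X : {mfun Omega >-> Y}) (v : R) (E1 E2 : set Y) :
  has_law Pr U (uniform_prob (@ltr01 R)) -> independent Pr U X ->
  0 <= v <= 1 -> measurable E1 -> measurable E2 ->
  fine (Pr [set w | if U w <= v then E1 (X w) else E2 (X w)]) =
  v * fine (Pr (X @^-1` E1)) + (1 - v) * fine (Pr (X @^-1` E2)).
Proof.
move=> lawU indep v01 mE1 mE2.
pose L : set R := `]-oo, v]%classic.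
have mL : measurable L by exact: measurable_itv.
have mUL : measurable (U @^-1` L).
  by rewrite -[X in measurable X]setTI; exact: measurable_funP.
have mX E : measurable E -> measurable (X @^-1` E).
  by move=> mE; rewrite -[X in measurable X]setTI; exact: measurable_funP.
have -> : [set w | if U w <= v then E1 (X w) else E2 (X w)] =
    (U @^-1` L `&` X @^-1` E1) `|` (U @^-1` (~` L) `&` X @^-1` E2).
  apply/seteqP; split => w; rewrite /L /= in_itv/=.
    by case: ifP => Uv; [left|right].
  by case: ifPn => [Uv [[//]|[]//]|Uv [[]//|[]//]].
rewrite measureU//; last 3 first.
- by apply: measurableI => //; exact: mX.
- by apply: measurableI; [rewrite preimage_setC; exact: measurableC|exact: mX].
- by apply/seteqP; split => w //= [[Uw _] [nUw _]]; exact: nUw.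
have UL : Pr (U @^-1` L) = v%:E.
  by rewrite [LHS](lawU _ mL) uniform_prob01_itvNy.
have UCL : Pr (U @^-1` (~` L)) = (1 - v)%:E.
  by rewrite preimage_setC probability_setC// UL.
have fin E : measurable E -> Pr (X @^-1` E) = (fine (Pr (X @^-1` E)))%:E.
  by move=> mE; rewrite fineK// fin_num_measure//; exact: mX.
have e1 : Pr (U @^-1` L `&` X @^-1` E1) = (v * fine (Pr (X @^-1` E1)))%:E.
  by rewrite [LHS](indep _ _ mL mE1) UL EFinM -fin.
have e2 : Pr (U @^-1` (~` L) `&` X @^-1` E2) =
    ((1 - v) * fine (Pr (X @^-1` E2)))%:E.
  by rewrite [LHS](indep _ _ (measurableC mL) mE2) UCL EFinM -fin.
exact: (congr2 (fun y z => fine (y + z)%E) e1 e2).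
Qed.

Theorem mainTheorem7 (R : realType)
  (dO : measure_display) (Omega : measurableType dO) (Pr : probability Omega R)
  (dT : measure_display) (T : measurableType dT) (P : probability T R)
  (d m B : nat) (m0 : (0 < m)%N)
  (phi : probability T R -> 'rV[R]_d) (S : 'rV[R]_d -> R) (tau alpha : R)
  (D : {RV Pr >-> m.-tuple T}) (Ds : 'I_B -> {RV Pr >-> m.-tuple T})
  (U : {RV Pr >-> R}) (F0 : {mfun m.-tuple T >-> R}) (b : 'I_B) :
  let theta0 := phi P in
  let theta_hat (x : m.-tuple T) := phi (empirical R m0 x) in
  let Sm (w : Omega) (theta : 'rV[R]_d) :=
    S (tau *: (theta_hat (D w) - theta)) in
  let W (w : Omega) (c : 'I_B) :=
    S (tau *: (theta_hat (Ds c w) - theta_hat (D w))) in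
  measurable_fun setT theta_hat ->
  measurable_fun setT S ->
  iid_sample Pr D P ->
  bootstrap_samples Pr m0 D Ds ->
  has_law Pr U (uniform_prob (@ltr01 R)) ->
  independent Pr U (fun w => (D w, [tuple Ds c w | c < B])) ->
  0 < alpha < 1 ->
  2 / alpha - 1 <= B%:R ->
  cond_prob_version Pr D [set w | W w b <= Sm w theta0] F0 ->
  `| fine (Pr [set w | CI_rand alpha (Sm w) (W w) (U w) theta0]) - (1 - alpha) |
  <= dKS (distribution Pr (F0 \o D)) (uniform_prob (@ltr01 R)).
Proof.
move=> theta0 theta_hat Sm W mth mS _ boot lawU indep a01 aB F0_version.
(* The statistics become functions of samples: [W_c] is [s] at [D] and [Ds c], and S_m(theta0) is
   [t] at [D]. *)
pose s (x y : m.-tuple T) := S (tau *: (theta_hat y - theta_hat x)).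
pose t (x : m.-tuple T) := S (tau *: (theta_hat x - theta0)).
have mcoord i : measurable_fun setT (fun x => theta_hat x ord0 i : measurableTypeR R).
  by have /measurable_rVP := mth; apply.
have ms : measurable_fun setT
    (fun z : m.-tuple T * m.-tuple T => s z.1 z.2).
  have mst : measurable_fun setT (fun z : m.-tuple T * m.-tuple T =>
      tau *: (theta_hat z.2 - theta_hat z.1)).
    apply/measurable_rVP => i; under eq_fun do rewrite !mxE.
    apply: measurable_funM => //; apply: measurable_funB.
      exact: (measurableT_comp (mcoord i) measurable_snd).
    exact: (measurableT_comp (mcoord i) measurable_fst).
  exact: (measurableT_comp mS mst).
have mt : measurable_fun setT t.
  have mst : measurable_fun setT (fun x => tau *: (theta_hat x - theta0)).
    apply/measurable_rVP => i; under eq_fun do rewrite !mxE.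
    by apply: measurable_funM => //; apply: measurable_funB => //; exact: mcoord.
  exact: (measurableT_comp mS mst).
pose X : {mfun Omega >-> (m.-tuple T * B.-tuple (m.-tuple T))%type} :=
  joint_sample D Ds.
have belowE w c : (c \in below s t (X w)) = (W w c <= Sm w theta0).
  by rewrite !inE/= tnth_mktuple.
have card_belowE w :
    #|[pred c | (W w c <= Sm w theta0)%R]| = #|below s t (X w)|.
  by apply: eq_card => c; rewrite belowE inE.
pose e := dKS (distribution Pr (F0 \o D)) (uniform_prob (@ltr01 R)).
pose x := B.+1%:R * (1 - alpha) : R.
pose l := ell alpha B.
pose E k : set (m.-tuple T * B.-tuple (m.-tuple T)) :=
  [set z | (l <= #|below s t z| < k + l)%N].
have mE k : measurable (E k).
  exact: (measurable_card_below ms mt (fun n => l <= n < k + l)%N).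
have Fv : cond_prob_version Pr D (X @^-1` [set z | b \in below s t z]) F0.
  rewrite (_ : X @^-1` _ = [set w | W w b <= Sm w theta0])//.
  by apply/seteqP; split => w /=; rewrite belowE.
(* Each branch of the randomization is compared with its own target [k / (B + 1)]; the targets
   average to [1 - alpha] only at the end. *)
have dist k : (k + l <= B)%N ->
    `|fine (Pr (X @^-1` E k)) - k%:R / B.+1%:R| <= e.
  move=> klB; rewrite (card_below_law ms mt boot).
  apply: (binomial_interval_dKS (good_law_ge0 D s t) (good_law_sum1 D ms mt)) => //.
  - by move=> g; exact: good_freq01.
  - exact: ell_gt0.
  - move=> u v u0 uv v1.
    rewrite -(cond_prob_itv ms mt boot Fv).
    have -> : v - u = fine (uniform_prob (@ltr01 R) `]u, v]%classic).
      by rewrite uniform_prob01_itvoc.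
    by apply: dKS_ge => u' v'; apply: fine_probability01; exact: measurable_itv.
have -> : [set w | CI_rand alpha (Sm w) (W w) (U w) theta0] =
    [set w | if U w <= tau_rand alpha B then E (nceil x) (X w)
             else E (nfloor x) (X w)].
  apply/seteqP; split => w /=.
    move=> /(CI_randE _ _ _ _ a01 aB); rewrite card_belowE.
    by case: ifP.
  move=> h; apply/(CI_randE _ _ _ _ a01 aB); rewrite card_belowE.
  by move: h; case: ifP.
rewrite randomized_prob//; last exact: tau_rand01.
rewrite -(tau_rand_mix B a01).
apply: ler_dist_mix; [exact: tau_rand01|apply: dist|apply: dist].
  exact: nceil_ell_le.
exact: nfloor_ell_le.
Qed.
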